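(* Consider the EV charging constraint sets $$\mathcal{C}(\bar r,E)=\{x\in\mathbb{R}^T\colon 0\preceq x\preceq\bar r,\ \mathbf{1}^Tx=E\}.$$ For any $i\in[n]$, the global $\ell_2$-sensitivity of the projection operator $\Pi_{\mathcal{C}_i(\bar r_i,E_i)}$ with respect to changes in $(\bar r_i,E_i)$ is bounded by $2\delta r+\delta E$, i.e. $$\Delta\le 2\delta r+\delta E,$$ where $$\Delta:=\max_{i\in[n]}\max\left\{\left\|\Pi_{\mathcal{C}(\bar r_i,E_i)}(r)-\Pi_{\mathcal{C}(\bar r_i',E_i')}(r)\right\|\colon r\in\mathbb{R}^T,\ \|\bar r_i-\bar r_i'\|_1\le\delta r,\ |E_i-E_i'|\le\delta E\right\}.$$
   Context: $\|\cdot\|$ is the $\ell_2$-norm, $\|\cdot\|_1$ the $\ell_1$-norm, $\mathbf{1}\in\mathbb{R}^T$ is the all-ones vector, and $\preceq$ is the componentwise inequality. $\Pi_{\mathcal{C}}(r)$ is the $\ell_2$-projection of $r$ onto the nonempty convex set $\mathcal{C}$. There are $n$ users; user $i\in[n]=\{1,\dots,n\}$ has constraint set $\mathcal{C}_i=\mathcal{C}(\bar r_i,E_i)$ with charging specification $(\bar r_i,E_i)$, $\bar r_i\in\mathbb{R}^T$, $E_i\in\mathbb{R}$. All specifications considered (including $(\bar r_i',E_i')$) are such that the constraints are feasible: $\bar r_i\succeq0$, $E_i>0$ and $\mathbf{1}^T\bar r_i\ge E_i$. The constants $\delta r,\delta E\ge0$ are given; they come from the adjacency relation in which two databases of specifications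 are adjacent if they differ only in one user $i$'s specification, with $\|\bar r_i-\bar r_i'\|_1\le\delta r$ and $|E_i-E_i'|\le\delta E$. *)

(* Defs.v *)
From mathcomp Require Import all_boot all_order all_algebra.
From mathcomp Require Import all_classical all_reals all_analysis.

Set Implicit Arguments.
Unset Strict Implicit.
Unset Printing Implicit Defensive.

Import Order.TTheory GRing.Theory Num.Theory.

Local Open Scope classical_set_scope.
Local Open Scope ring_scope.

(* Vectors of R^T are row vectors.  The library norm on 'rV[R]_T is the
   max-norm, hence the explicit l2 and l1 norms. *)
Definition l2norm (R : realType) (T : nat) (x : 'rV[R]_T) : R :=
  Num.sqrt (\sum_t x 0 t ^+ 2).

Definition l1norm (R : realType) (T : nat) (x : 'rV[R]_T) : R :=
  \sum_t `|x 0 t|.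

Definition is_projection (R : realType) (T : nat) (C : set 'rV[R]_T)
    (r x : 'rV[R]_T) : Prop :=
  C x /\ forall y, C y -> l2norm (r - x) <= l2norm (r - y).

(* The l2-projection of r onto C; the default value 0 is only returned when no
   nearest point exists, which does not happen for C nonempty closed convex. *)
Definition projection (R : realType) (T : nat) (C : set 'rV[R]_T)
    (r : 'rV[R]_T) : 'rV[R]_T :=
  xget 0 [set x | is_projection C r x].

Record specification (R : realType) (T : nat) := Specification {
  max_rate : 'rV[R]_T;
  energy : R
}.

Definition charging_set (R : realType) (T : nat) (s : specification R T) :
    set 'rV[R]_T :=
  [set x | (forall t, 0 <= x 0 t <= max_rate s 0 t)
           /\ \sum_t x 0 t = energy s].

Definition feasible (R : realType) (T : nat) (s : specification R T) : Prop :=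
  [/\ forall t, 0 <= max_rate s 0 t,
      0 < energy s
    & energy s <= \sum_t max_rate s 0 t].

Definition database (R : realType) (T n : nat) := 'I_n -> specification R T.

Definition adjacent_at (R : realType) (T n : nat) (dr dE : R) (i : 'I_n)
    (D D' : database R T n) : Prop :=
  [/\ forall j, j != i -> D j = D' j,
      l1norm (max_rate (D i) - max_rate (D' i)) <= dr
    & `|energy (D i) - energy (D' i)| <= dE].

(* The sensitivity Delta.  Both maxima are taken as suprema in the extended
   reals, so that the quantity is meaningful without presupposing that it is
   finite or attained. *)
Definition sensitivity (R : realType) (T n : nat) (dr dE : R) : \bar R :=
  ereal_sup [set ereal_sup
    [set d | exists (r : 'rV[R]_T) (D D' : database R T n),
       [/\ forall j, feasible (D j), forall j, feasible (D' j),
           adjacent_at dr dE i D D'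
         & d = (l2norm (projection (charging_set (D i)) r
                        - projection (charging_set (D' i)) r))%:E]]
    | i in [set: 'I_n]].

(* Main.v *)
Require Import Defs.
From mathcomp Require Import all_boot all_order all_algebra.
From mathcomp Require Import all_classical all_reals all_analysis.
From mathcomp Require Import ring lra.

Import Order.TTheory GRing.Theory Num.Theory.
Import numFieldNormedType.Exports.

Local Open Scope ring_scope.

(** Each projection has a water-filling form: for a suitable multiplier nu of
    the energy constraint, the point of C(a, E) nearest to r has coordinates
    clip (r_t - nu) into [0, a_t]. Such a nu exists because the total of the
    clipped vector depends continuously on nu and runs from the sum of the a_t
    down to 0 ([exists_multiplier]); coordinatewise, clipping satisfies the
    obtuse-angle inequality, and on vectors of equal total the terms in nu
    cancel, so the clipped vector is the unique nearest point
    ([projection_shift_clip]).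

    To compare two such projections x (caps a, multiplier nu) and x' (caps a',
    multiplier nu'), suppose nu <= nu' and pass through the point y with caps a
    and multiplier nu'. Clipping is 1-Lipschitz in the cap, so y and x' are at
    l1-distance at most |a - a'|_1 <= dr. Clipping is monotone, so y is below x
    coordinatewise, and the l1-distance of x and y is merely the difference of
    their totals, E - sum y = (E - E') + (sum x' - sum y) <= dE + dr. Hence the
    projections are at l1-distance, and a fortiori l2-distance, at most
    2 dr + dE. *)

Section Norms.
Variables (R : realType) (T : nat).
Implicit Types x y z : 'rV[R]_T.

Lemma l2norm_le_l1norm x : l2norm x <= l1norm x.
Proof.
have l1_ge0 : 0 <= l1norm x by exact: sumr_ge0.
rewrite /l2norm -[leRHS]ger0_norm // -sqrtr_sqr ler_sqrt ?sqr_ge0 //.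
rewrite expr2 /l1norm mulr_suml ler_sum // => t _.
rewrite -real_normK ?num_real // expr2 ler_wpM2l //.
by rewrite (bigD1 t) //= lerDl sumr_ge0.
Qed.

Lemma l1norm_sub_sym x y : l1norm (x - y) = l1norm (y - x).
Proof. by apply: eq_bigr => t _; rewrite !mxE distrC. Qed.

Lemma l1norm_triangle x y z : l1norm (x - z) <= l1norm (x - y) + l1norm (y - z).
Proof.
rewrite /l1norm -big_split ler_sum // => t _.
by rewrite !mxE ler_distD.
Qed.

Lemma sum_sub_le_l1norm x y : \sum_t x 0 t - \sum_t y 0 t <= l1norm (x - y).
Proof. by rewrite -sumrB ler_sum // => t _; rewrite !mxE ler_norm. Qed.

Lemma l1norm_sub_ge x y :
  (forall t, y 0 t <= x 0 t) -> l1norm (x - y) = \sum_t x 0 t - \sum_t y 0 t.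
Proof.
move=> yx; rewrite -sumrB; apply: eq_bigr => t _.
by rewrite !mxE ger0_norm // subr_ge0.
Qed.

(** A variational inequality at x makes the squared distance to r grow by at
    least |x - y|^2 on moving from x to y, whence minimality and uniqueness. *)
Lemma projection_unique (C : set 'rV[R]_T) (r x : 'rV[R]_T) :
  C x -> (forall y, C y -> \sum_t (r 0 t - x 0 t) * (y 0 t - x 0 t) <= 0) ->
  projection C r = x.
Proof.
move=> Cx obtuse.
have growth y : C y ->
    \sum_t (r - x) 0 t ^+ 2 + \sum_t (y - x) 0 t ^+ 2 <= \sum_t (r - y) 0 t ^+ 2.
  move=> Cy; rewrite -big_split /= -subr_ge0 -sumrB.
  under eq_bigr => t _.
    rewrite !mxE.
    have -> : (r 0 t - y 0 t) ^+ 2 - ((r 0 t - x 0 t) ^+ 2 + (y 0 t - x 0 t) ^+ 2)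
      = - (2 * ((r 0 t - x 0 t) * (y 0 t - x 0 t))) by ring.
    over.
  by rewrite sumrN -mulr_sumr oppr_ge0 pmulr_rle0 // obtuse.
have sumsq_ge0 z : 0 <= \sum_t z 0 t ^+ 2 :> R.
  by apply: sumr_ge0 => t _; exact: sqr_ge0.
apply: xget_unique => [|y [Cy]].
  split=> // y Cy; rewrite ler_wsqrtr //.
  by apply: le_trans (growth y Cy); rewrite lerDl.
move=> /(_ x Cx); rewrite ler_sqrt // => ryx.
have yx0 : \sum_t (y - x) 0 t ^+ 2 = 0.
  by apply/eqP; rewrite eq_le sumsq_ge0 andbT; have := growth y Cy; lra.
apply/rowP => t; apply/eqP; rewrite -subr_eq0 -sqrf_eq0.
have /psumr_eq0P/(_ yx0 t isT) : forall t, true -> 0 <= (y - x) 0 t ^+ 2.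
  by move=> u _; exact: sqr_ge0.
by rewrite !mxE => ->.
Qed.

End Norms.

Section Clip.
Variable R : realType.
Implicit Types a b z : R.

Definition clip a z : R := Num.max 0 (Num.min z a).

Lemma clip_itv a z : 0 <= a -> 0 <= clip a z <= a.
Proof. by move=> a0; rewrite le_max lexx ge_max a0 ge_min lexx orbT. Qed.

Lemma clip_le0 a z : z <= 0 -> clip a z = 0.
Proof. by move=> z0; rewrite /clip max_l // ge_min z0. Qed.

Lemma clip_ge a z : 0 <= a -> a <= z -> clip a z = a.
Proof. by move=> a0 az; rewrite /clip min_r // max_r. Qed.

Lemma clip_spec a z : 0 <= a ->
  [\/ z <= 0 /\ clip a z = 0, 0 <= z <= a /\ clip a z = z
    | a <= z /\ clip a z = a].
Proof.
move=> a0; have [z0|/ltW z0] := leP z 0.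
  by constructor 1; rewrite clip_le0.
have [za|/ltW az] := leP z a; last by constructor 3; rewrite clip_ge.
by constructor 2; rewrite z0 /clip min_l // max_r.
Qed.

Lemma clip_monotone a z z' : 0 <= a -> z <= z' -> clip a z <= clip a z'.
Proof.
move=> a0 zz'.
by case: (clip_spec _ z a0) => -[? ->]; case: (clip_spec _ z' a0) => -[? ->]; lra.
Qed.

Lemma clip_lipschitz_cap a b z :
  0 <= a -> 0 <= b -> `|clip a z - clip b z| <= `|a - b|.
Proof.
move=> a0 b0; have := ler_norm (a - b); have := ler_norm (b - a).
rewrite (distrC b a) ler_norml => ? ?.
by case: (clip_spec _ z a0) => -[? ->]; case: (clip_spec _ z b0) => -[? ->];
  apply/andP; split; lra.
Qed.

(** The clipped value is the nearest point of [0, a], so the direction from it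
    to z makes an obtuse angle with every direction into the interval. *)
Lemma clip_obtuse a z w :
  0 <= w <= a -> (z - clip a z) * (w - clip a z) <= 0.
Proof.
move=> /andP[w0 wa]; have a0 := le_trans w0 wa.
by case: (clip_spec _ z a0) => -[? ->]; nra.
Qed.

Lemma clip_continuous a : continuous (clip a).
Proof.
move=> z; apply: (@continuous_max _ _ (cst 0) (fun z => Num.min z a)).
  exact: cst_continuous.
apply: (@continuous_min _ _ id (cst a)); first exact: cvg_id.
exact: cst_continuous.
Qed.

End Clip.

Arguments clip {R}.

Section WaterFilling.
Variables (R : realType) (T : nat).
Implicit Types (r a : 'rV[R]_T) (nu E : R).

Definition shift_clip r a nu : 'rV[R]_T := \row_t clip (a 0 t) (r 0 t - nu).

Lemma total_shift_clip_continuous r a :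
  continuous (fun nu : R => \sum_t shift_clip r a nu 0 t).
Proof.
apply: continuous_big => [|t _ nu]; first exact: add_continuous.
have -> : (fun nu => shift_clip r a nu 0 t)
  = clip (a 0 t) \o (fun nu => r 0 t - nu) by apply/funext => u; rewrite mxE.
apply: continuous_comp; last exact: clip_continuous.
by apply: cvgB; [exact: cvg_cst | exact: cvg_id].
Qed.

Lemma exists_multiplier r a E :
  (forall t, 0 <= a 0 t) -> 0 <= E <= \sum_t a 0 t ->
  exists nu, \sum_t shift_clip r a nu 0 t = E.
Proof.
move=> a0 E_itv.
(* Shifting r by B empties every coordinate, shifting it by - B fills it. *)
pose B := \sum_t (`|r 0 t| + a 0 t).
have le_B t : `|r 0 t| + a 0 t <= B.
  by rewrite /B (bigD1 t) //= lerDl sumr_ge0 // => u _; rewrite addr_ge0.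
have B0 : 0 <= B by apply: sumr_ge0 => t _; rewrite addr_ge0.
have empty : \sum_t shift_clip r a B 0 t = 0.
  apply: big1 => t _; rewrite mxE clip_le0 // subr_le0.
  by have := le_B t; have := a0 t; have := ler_norm (r 0 t); lra.
have full : \sum_t shift_clip r a (- B) 0 t = \sum_t a 0 t.
  apply: eq_bigr => t _; rewrite mxE clip_ge //.
  by have := le_B t; have := ler_norm (- r 0 t); rewrite normrN; lra.
have [|||nu _ <-] := @IVT _ (fun nu => \sum_t shift_clip r a nu 0 t) (- B) B E.
- by lra.
- by apply: continuous_subspaceT; exact: total_shift_clip_continuous.
- have /andP[E0 Ea] := E_itv.
  by rewrite empty full min_r ?max_l ?E0 //; exact: le_trans Ea.
by exists nu.
Qed.

Lemma projection_shift_clip r a E nu :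
  (forall t, 0 <= a 0 t) -> \sum_t shift_clip r a nu 0 t = E ->
  projection (charging_set (Specification a E)) r = shift_clip r a nu.
Proof.
move=> a0 totalE; apply: projection_unique => [|y [y_itv y_total]].
  by split=> // t; rewrite mxE clip_itv.
pose x := shift_clip r a nu.
rewrite -/x.
(* The nu-part of the inner product is nu times a difference of totals. *)
have -> : \sum_t (r 0 t - x 0 t) * (y 0 t - x 0 t)
    = \sum_t (r 0 t - nu - x 0 t) * (y 0 t - x 0 t).
  have nu0 : \sum_t nu * (y 0 t - x 0 t) = 0.
    by rewrite -mulr_sumr sumrB y_total totalE subrr mulr0.
  rewrite -[RHS]addr0 -[X in _ = _ + X]nu0 -big_split /=; apply: eq_bigr => t _; ring.
apply: sumr_le0 => t _; rewrite mxE; exact: clip_obtuse.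
Qed.

Lemma l1norm_shift_clip_cap r a a' nu :
  (forall t, 0 <= a 0 t) -> (forall t, 0 <= a' 0 t) ->
  l1norm (shift_clip r a nu - shift_clip r a' nu) <= l1norm (a - a').
Proof. by move=> a0 a'0; apply: ler_sum => t _; rewrite !mxE clip_lipschitz_cap. Qed.

(** The intermediate point has the caps a and the multiplier nu'. It lies below
    the first vector and near the second, which controls its total. *)
Lemma l1norm_shift_clip_le r a a' nu nu' :
  (forall t, 0 <= a 0 t) -> (forall t, 0 <= a' 0 t) -> nu <= nu' ->
  l1norm (shift_clip r a nu - shift_clip r a' nu') <=
    2 * l1norm (a - a') +
    `|\sum_t shift_clip r a nu 0 t - \sum_t shift_clip r a' nu' 0 t|.
Proof.
move=> a0 a'0 nunu'; set x := shift_clip r a nu; set x' := shift_clip r a' nu'.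
pose y := shift_clip r a nu'.
have yx t : y 0 t <= x 0 t by rewrite !mxE clip_monotone // lerD2l lerN2.
have yx' : l1norm (y - x') <= l1norm (a - a') by exact: l1norm_shift_clip_cap.
have := l1norm_triangle _ _ x y x'; rewrite (l1norm_sub_ge _ _ _ _ yx).
have := sum_sub_le_l1norm _ _ x' y; rewrite l1norm_sub_sym.
have := ler_norm (\sum_t x 0 t - \sum_t x' 0 t).
by lra.
Qed.

(** The two totals of the clipped vectors are the two energies, so the previous
    bound becomes one in the specifications alone; the bound being symmetric,
    the specifications may be ordered by their multipliers. *)
Lemma projection_charging_set_lipschitz (s s' : specification R T) r :
  feasible s -> feasible s' ->
  l1norm (projection (charging_set s) r - projection (charging_set s') r) <=
    2 * l1norm (max_rate s - max_rate s') + `|energy s - energy s'|.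
Proof.
case: s s' => a E [a' E'] [/= a0 E0 Ea] [/= a'0 E'0 E'a'].
have [|nu nuE] := exists_multiplier r a E a0; first by rewrite ltW.
have [|nu' nuE'] := exists_multiplier r a' E' a'0; first by rewrite ltW.
rewrite (projection_shift_clip _ _ _ _ a0 nuE).
rewrite (projection_shift_clip _ _ _ _ a'0 nuE') -nuE -nuE'.
have [nunu'|/ltW nu'nu] := leP nu nu'; first exact: l1norm_shift_clip_le.
rewrite l1norm_sub_sym (l1norm_sub_sym _ _ a) distrC.
exact: l1norm_shift_clip_le.
Qed.

End WaterFilling.

Theorem theorem8 (R : realType) (T n : nat) (dr dE : R)
    (hdr : 0 <= dr) (hdE : 0 <= dE) :
  (sensitivity T n dr dE <= (2 * dr + dE)%:E)%E.
Proof.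
apply: ge_ereal_sup => _ [i _ <-].
apply: ge_ereal_sup => _ [r [D [D' [feasD feasD' [_ rate_near energy_near] ->]]]].
rewrite lee_fin; apply: le_trans (l2norm_le_l1norm _ _ _) _.
apply: le_trans (projection_charging_set_lipschitz _ _ _ _ r (feasD i) (feasD' i)) _.
by lra.
Qed.
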